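(* Let $K$ be an algebraically closed field of characteristic different from $2$. Consider the matrix algebras with involution $(M_{n_1}(K),*_1)$ and $(M_{n_2}(K),*_2)$, where $n_1,n_2$ are positive integers, each $*_i$ is either the transpose involution $t$ or the symplectic involution $s$, and $n_i$ is even whenever $*_i=s$. (a) If $\mathrm{Id}(M_{n_1}(K),*_1)\subseteq \mathrm{Id}(M_{n_2}(K),*_2)$, then there is an embedding of $K$-algebras $M_{n_2}(K)\hookrightarrow M_{n_1}(K)$. (b) Suppose $*_1$ and $*_2$ are of the same kind $*$ (both transpose or both symplectic). If $\mathrm{Id}(M_{n_1}(K),* )\subseteq \mathrm{Id}(M_{n_2}(K),* )$, then there is an involution-preserving embedding $(M_{n_2}(K),* )\hookrightarrow (M_{n_1}(K),* )$. (c) Suppose $*_1=s$ and $*_2=*$ is either $t$ or $s$. If $\mathrm{Id}(M_{n_1}(K),s)\subseteq \mathrm{Id}(M_{n_2}(K),* )$, then there is an involution-preserving embedding $(M_{n_2}(K),* )\hookrightarrow (M_{n_1}(K),s)$.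
   Context: An involution on a $K$-algebra $A$ is a $K$-linear map $*\colon A\to A$ with $(ab)^*=b^*a^*$ and $(a^* )^*=a$. Put $A^+=\{a: a^*=a\}$ and $A^-=\{a: a^*=-a\}$. Let $K\langle Y,Z\rangle$ be the free associative algebra on countably many non-commuting variables $y_1,y_2,\dots$ (symmetric) and $z_1,z_2,\dots$ (skew-symmetric). A polynomial $f(y_1,\dots,y_p,z_1,\dots,z_q)\in K\langle Y,Z\rangle$ is a $*$-identity of $(A,* )$ if $f(u_1,\dots,u_p,v_1,\dots,v_q)=0$ for all $u_i\in A^+$ and $v_j\in A^-$. The set of all $*$-identities of $(A,* )$ is denoted $\mathrm{Id}(A,* )$. $t$ denotes the transpose involution $(a_{ij})^t=(a_{ji})$ on $M_n(K)$. For $n=2k$ even, $s$ denotes the symplectic involution $a^s=Ta^tT^{-1}$ on $M_{2k}(K)$, where $T=\sum_{i=1}^{k}(e_{i,i+k}-e_{i+k,i})$ and the $e_{ij}$ are the matrix units. An embedding of $K$-algebras is an injective $K$-linear multiplicative map; it is not required to send the unit to the unit. An embedding $\varphi\colon A\to B$ of algebras with involution is involution-preserving if $\varphi(a^{*})=\varphi(a)^{*}$ for all $a\in A$ (each side using the involution of the respective algebra). *)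

(* Defs.v *)
From HB Require Import structures.
From mathcomp Require Import all_boot all_order all_algebra.
From mathcomp Require Import monalg.

Set Implicit Arguments.
Unset Strict Implicit.
Unset Printing Implicit Defensive.

Import GRing.Theory.
Local Open Scope ring_scope.

Section AlgebrasWithInvolution.

Variables (K : fieldType) (A B : algType K).

Definition is_involution (star : A -> A) : Prop :=
  [/\ linear star,
      forall a b, star (a * b) = star b * star a
    & involutive star].

Definition symmetric_elt (star : A -> A) (a : A) : Prop := star a = a.

Definition skew_elt (star : A -> A) (a : A) : Prop := star a = - a.

(* [phi 1] need not be 1. *)
Definition alg_embedding (phi : A -> B) : Prop :=
  [/\ injective phi, linear phi & {morph phi : a b / a * b}].

Definition star_embedding (starA : A -> A) (starB : B -> B) (phi : A -> B)
    : Prop :=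
  alg_embedding phi /\ forall a, phi (starA a) = starB (phi a).

End AlgebrasWithInvolution.

(* K<Y,Z>: the variable y_i is [inl i] and z_i is [inr i]; elements of the   *)
(* free monoid {fmonom _} are words in the variables.                        *)
Notation free_star_alg K := {malg K[{fmonom (nat + nat)%type}]}.

Definition free_eval (K : fieldType) (A : algType K) (u v : nat -> A)
    (f : free_star_alg K) : A :=
  mmap (in_alg A)
    (fun w : {fmonom (nat + nat)%type} =>
       \prod_(x <- fmonom_val w)
          match x with inl i => u i | inr j => v j end)
    f.

Definition star_identity (K : fieldType) (A : algType K) (star : A -> A)
    (f : free_star_alg K) : Prop :=
  forall u v : nat -> A,
    (forall i, symmetric_elt star (u i)) ->
    (forall j, skew_elt star (v j)) ->
    free_eval u v f = 0.

Definition star_identities_sub (K : fieldType) (A B : algType K)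
    (starA : A -> A) (starB : B -> B) : Prop :=
  forall f : free_star_alg K, star_identity starA f -> star_identity starB f.

Section MatrixInvolutions.

Variable K : fieldType.

(* T = \sum_(i = 1 .. k) (e_(i, i + k) - e_(i + k, i)), indices shifted to   *)
(* start at 0, where the size m.+1 is meant to be even and k is its half.    *)
Definition symplectic_mx (m : nat) : 'M[K]_m.+1 :=
  let k := m.+1./2 in
  \sum_(i < k) (delta_mx (inord i) (inord (i + k))
                - delta_mx (inord (i + k)) (inord i)).

Definition symplectic_star (m : nat) (a : 'M[K]_m.+1) : 'M[K]_m.+1 :=
  symplectic_mx m *m a^T *m invmx (symplectic_mx m).

Inductive star_kind := Transpose | Symplectic.

Definition mx_star (s : star_kind) (m : nat) (a : 'M[K]_m.+1) : 'M[K]_m.+1 :=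
  match s with
  | Transpose => a^T
  | Symplectic => symplectic_star a
  end.

Arguments mx_star s {m} a.

Lemma tr_symplectic_mx m : (symplectic_mx m)^T = - symplectic_mx m.
Proof.
rewrite /symplectic_mx linear_sum -sumrN; apply: eq_bigr => i _.
by rewrite linearB /= trmx_delta trmx_delta opprB.
Qed.

Lemma symplectic_mx_sqr m :
  ~~ odd m.+1 -> symplectic_mx m *m symplectic_mx m = - 1%:M.
Proof.
move=> ev; have dm : (m.+1./2 + m.+1./2)%N = m.+1.
  by rewrite addnn -[RHS]odd_double_half (negPf ev).
rewrite {-1}/symplectic_mx mulmx_sumr; set k := m.+1./2 in dm *.
have lk (i : 'I_k) : (i < m.+1)%N by rewrite -dm ltn_addr.
have rk (i : 'I_k) : (i + k < m.+1)%N by rewrite -dm ltn_add2r.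
pose l (i : 'I_k) : 'I_m.+1 := inord i.
pose r (i : 'I_k) : 'I_m.+1 := inord (i + k).
have lE i : l i = i :> nat by rewrite inordK.
have rE i : r i = (i + k)%N :> nat by rewrite inordK.
have ll i j : (l i == l j) = (i == j) by rewrite -(inj_eq (@ord_inj _)) !lE.
have rr i j : (r i == r j) = (i == j).
  by rewrite -(inj_eq (@ord_inj _)) !rE eqn_add2r.
have lr i j : (l i == r j) = false.
  rewrite -(inj_eq (@ord_inj _)) lE rE; apply/negbTE.
  by rewrite neq_ltn (leq_trans (ltn_ord i)) ?leq_addl.
have rl i j : (r i == l j) = false by rewrite eq_sym.
transitivity (\sum_(i < k) - (delta_mx (l i) (l i) + delta_mx (r i) (r i))
              : 'M[K]_m.+1).
  apply: eq_bigr => i _; rewrite /symplectic_mx mulmx_suml (bigD1 i) //=.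
  rewrite big1 => [|j ji]; rewrite -/k -/(l _) -/(r _) mulmxBl !mulmxBr.
    rewrite !mul_delta_mx_cond !rl !lr !ll !rr !eqxx.
    by rewrite !mulr0n !mulr1n subr0 !sub0r addr0 opprD.
  rewrite -/(l j) -/(r j) !mul_delta_mx_cond !rl !lr !ll !rr (negPf ji).
  by rewrite !mulr0n !subr0.
rewrite sumrN; congr (- _); rewrite big_split /=.
apply/matrixP => a b; rewrite !mxE !summxE.
under eq_bigr do rewrite mxE.
under [X in _ + X]eq_bigr do rewrite mxE.
have [ak|ka] := ltnP a k.
  have -> : a = l (Ordinal ak) by apply/ord_inj; rewrite lE.
  rewrite (bigD1 (Ordinal ak)) //= big1 => [|j]; last first.
    by rewrite ll eq_sym => /negPf ->.
  rewrite big1 => [|j _]; last by rewrite lr.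
  by rewrite eqxx !addr0 eq_sym.
have ak : (a - k < k)%N by rewrite ltn_subLR // dm.
have -> : a = r (Ordinal ak) by apply/ord_inj; rewrite rE subnK.
rewrite addrC (bigD1 (Ordinal ak)) //= big1 => [|j]; last first.
  by rewrite rr eq_sym => /negPf ->.
rewrite big1 => [|j _]; last by rewrite rl.
by rewrite eqxx !addr0 eq_sym.
Qed.

Lemma symplectic_mx_unit m : ~~ odd m.+1 -> symplectic_mx m \in unitmx.
Proof.
move=> /symplectic_mx_sqr sq.
have : symplectic_mx m *m - symplectic_mx m = 1%:M.
  by rewrite mulmxN sq opprK.
by case/mulmx1_unit.
Qed.

Lemma mx_star_involution s m :
  (s = Symplectic -> ~~ odd m.+1) ->
  is_involution (mx_star s : 'M[K]_m.+1 -> 'M[K]_m.+1).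
Proof.
case: s => [_|/(_ erefl) ev]; split=> /=.
- by move=> c a b; rewrite /mx_star linearP.
- by move=> a b; rewrite trmx_mul.
- exact: trmxK.
- move=> c a b; rewrite /mx_star /symplectic_star linearP /=.
  by rewrite mulmxDr mulmxDl -scalemxAr -scalemxAl.
- move=> a b; rewrite /symplectic_star trmx_mul -[RHS]/(_ *m _) !mulmxA.
  by rewrite mulmxKV // symplectic_mx_unit.
- move=> a; rewrite /mx_star /symplectic_star !trmx_mul trmx_inv.
  rewrite tr_symplectic_mx trmxK.
  have uT := symplectic_mx_unit ev.
  have -> : invmx (- symplectic_mx m) = - invmx (symplectic_mx m).
    by apply: (invrN (symplectic_mx m)).
  by rewrite !(mulmxN, mulNmx) opprK !mulmxA mulmxV // mul1mx mulmxK.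
Qed.

End MatrixInvolutions.

Arguments mx_star {K} s {m} a.

(* Main.v *)
Require Import Defs.
From HB Require Import structures.
From mathcomp Require Import all_boot all_order all_algebra.
From mathcomp Require Import perm monalg.

Set Implicit Arguments.
Unset Strict Implicit.
Unset Printing Implicit Defensive.

Import GRing.Theory.
Local Open Scope ring_scope.

(* The polynomial  c_m(x, w) = \sum_(s in S_(m+1)) sgn(s) \prod_j x_j w^(s j)   *)
(* vanishes as soon as w is annihilated by a polynomial of degree m, and takes *)
(* a nonzero value (a Vandermonde determinant times a matrix unit) when w is   *)
(* diagonal with m+1 distinct eigenvalues and the x_j are suitable matrix      *)
(* units. With w = y + z and m = n_1, Cayley-Hamilton makes c_m an identity of *)
(* M_(n_1), so inclusion of the identities forces n_2 <= n_1. With w = y and   *)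
(* n_1 = 2m, a symmetric element for the symplectic involution is annihilated  *)
(* by a polynomial of degree m, so inclusion in the identities of              *)
(* (M_(n_2), t) forces n_2 <= m. These bounds suffice for block embeddings.    *)

(** Only sizes matter. [star_identities_sub_leq] extracts n_2 <= n_1 from the inclusion of
    identities, and [symplectic_transpose_leq] extracts 2 n_2 <= n_1 when s is compared with t. The
    polynomial c_m detects both: [capelli_powers_annihilated] makes it vanish on w of degree at most
    m, [capelli_powers_neq0] makes it survive in size m+1 or more, and [symplectic_sym_annihilator]
    halves the degree for symplectic-symmetric w. Conversely, E with E E^T = 1 embeds the small
    algebra as a corner a -> E^T a E. This respects t; it respects s if E also intertwines the two
    symplectic forms; and (M_n, t) sits in (M_(2n), s) as diag(a, a). *)

Section FreeEval.

Variables (K : fieldType) (A : algType K) (u v : nat -> A).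

Let word_eval (w : {fmonom (nat + nat)%type}) : A :=
  \prod_(x <- fmonom_val w) match x with inl i => u i | inr j => v j end.

Let word_eval_is_mmorphism : mmorphism word_eval.
Proof.
by split=> [w1 w2|]; rewrite /word_eval ?fm1 ?big_nil // fmM big_cat.
Qed.

HB.instance Definition _ :=
  isMultiplicative.Build _ _ word_eval word_eval_is_mmorphism.

Lemma free_eval_is_additive : additive (free_eval u v).
Proof. exact: (@mmap_is_additive _ _ _ (in_alg A) word_eval). Qed.

Lemma free_eval_is_multiplicative : multiplicative (free_eval u v).
Proof.
apply: (@commr_mmap_is_multiplicative _ _ _ (in_alg A) word_eval) => g m m' /=.
by rewrite /GRing.comm mulr_algl mulr_algr.
Qed.

HB.instance Definition _ := GRing.isAdditive.Build
  (free_star_alg K) A (free_eval u v) free_eval_is_additive.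
HB.instance Definition _ := GRing.isMultiplicative.Build
  (free_star_alg K) A (free_eval u v) free_eval_is_multiplicative.

Lemma free_evalU x :
  free_eval u v << fmu x >> = match x with inl i => u i | inr j => v j end.
Proof.
rewrite /free_eval (@mmapU _ _ _ (in_alg A)) /= scale1r mul1r.
by rewrite fmU big_seq1.
Qed.

End FreeEval.

(** * The polynomial c_m: vanishing and nonvanishing *)

(** A Capelli polynomial with its alternating slots filled by 1, w, ..., w^m. Any ring is allowed,
    so the formula makes sense both in the free algebra and in matrices. *)
Definition capelli_powers (A : nzRingType) (m : nat) (x : nat -> A) (w : A) : A :=
  \sum_(s : 'S_m.+1) (-1) ^+ s * \prod_(j < m.+1) (x j * w ^+ s j).

Lemma rmorph_capelli_powers (A B : nzRingType) (f : {rmorphism A -> B}) m x w :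
  f (capelli_powers m x w) = capelli_powers m (f \o x) (f w).
Proof.
rewrite rmorph_sum; apply: eq_bigr => s _ /=.
rewrite rmorphM rmorph_sign rmorph_prod; congr (_ * _).
by apply: eq_bigr => j _; rewrite rmorphM rmorphXn.
Qed.

(* Expanding the powers of [w] on [m] of them, the coefficient of each product *)
(* is a determinant of size [m.+1] with two equal rows.                        *)
Lemma capelli_powers_eq0 (K : fieldType) (A : algType K) m (x : nat -> A) (w : A)
    (c : 'I_m.+1 -> 'I_m -> K) :
  (forall i : 'I_m.+1, w ^+ i = \sum_(l < m) c i l *: w ^+ l) ->
  capelli_powers m x w = 0.
Proof.
move=> wE; rewrite /capelli_powers.
transitivity (\sum_(s : 'S_m.+1) \sum_(g : {ffun 'I_m.+1 -> 'I_m})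
    ((-1) ^+ s * \prod_(j < m.+1) c (s j) (g j)) *: \prod_(j < m.+1) (x j * w ^+ g j)).
  apply: eq_bigr => s _.
  transitivity ((-1) ^+ s *
      \prod_(j < m.+1) \sum_(l < m) c (s j) l *: (x j * w ^+ l)).
    congr (_ * _); apply: eq_bigr => j _; rewrite wE mulr_sumr.
    by apply: eq_bigr => l _; rewrite -scalerAr.
  rewrite bigA_distr_bigA mulr_sumr; apply: eq_bigr => g _ /=.
  rewrite scaler_prod -scalerA.
  by case: (odd_perm s); rewrite ?mul1r ?scale1r // expr1 mulN1r scaleN1r.
rewrite exchange_big big1 //= => g _; rewrite -scaler_suml.
pose C := \matrix_(j < m.+1, i < m.+1) c i (g j).
have /injectivePn [j1 [j2 neq_j eq_g]] : ~~ injectiveb g.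
  by apply/negP => /injectiveP /leq_card; rewrite !card_ord ltnn.
rewrite (_ : \sum_s _ = \det C); last first.
  by apply: eq_bigr => s _; congr (_ * _); apply: eq_bigr => j _; rewrite mxE.
rewrite (determinant_alternate neq_j) ?scale0r // => i.
by rewrite !mxE eq_g.
Qed.

(** Reducing X^i modulo q writes each w^i as a combination of the m powers 1, ..., w^(m-1). *)
Lemma capelli_powers_annihilated (K : fieldType) n m (x : nat -> 'M[K]_n.+1)
    (w : 'M[K]_n.+1) (q : {poly K}) :
  size q = m.+1 -> horner_mx w q = 0 -> capelli_powers m x w = 0.
Proof.
move=> sz_q qw0; have q0 : q != 0 by rewrite -size_poly_eq0 sz_q.
apply: (@capelli_powers_eq0 _ _ _ _ _ (fun i l => ('X^i %% q)`_l)) => i.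
have sz_r : (size ('X^i %% q)%R <= m)%N.
  by have := ltn_modp 'X^i q; rewrite q0 sz_q ltnS.
transitivity (horner_mx w ('X^i %% q)).
  have := congr1 (horner_mx w) (divp_eq 'X^i q).
  by rewrite rmorphD rmorphM /= qw0 mulr0 add0r rmorphXn /= horner_mx_X.
rewrite -{1}[_ %% _]coefK poly_def rmorph_sum /=.
(* The remainder may have fewer than m coefficients; the sum is padded with zeros. *)
rewrite (big_ord_widen _ (fun l => horner_mx w (('X^i %% q)`_l *: 'X^l)) sz_r).
rewrite [RHS](bigID (fun l : 'I_m => (l < size ('X^i %% q)%R)%N)) /=.
rewrite [X in _ = _ + X]big1 ?addr0 => [|l]; last first.
  by rewrite -leqNgt => le_l; rewrite nth_default // scale0r.
by apply: eq_bigr => l _; rewrite linearZ /= rmorphXn /= horner_mx_X.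
Qed.

Lemma closed_field_uniq (K : closedFieldType) n :
  exists2 s : seq K, size s = n & uniq s.
Proof.
elim: n => [|n [s sz_s uniq_s]]; first by exists [::].
have /closed_nonrootP [x] : \prod_(a <- s) ('X - a%:P) != 0.
  by rewrite monic_neq0 ?monic_prod_XsubC.
by rewrite root_prod_XsubC => xs; exists (x :: s); rewrite /= ?sz_s ?xs.
Qed.

(** The product e_00 e_01 e_12 ... telescopes; since [0.-1] is 0, the factor at j = 0 is the
    idempotent e_00. *)
Lemma prod_delta_mx_path (K : fieldType) n m : (m <= n)%N ->
  \prod_(j < m.+1) (delta_mx (inord j.-1) (inord j) : 'M[K]_n.+1)
    = delta_mx (inord 0) (inord m).
Proof.
elim: m => [|m IHm] le_mn; first by rewrite big_ord1.
by rewrite big_ord_recr /= IHm 1?ltnW // -[LHS]/(_ *m _) mul_delta_mx.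
Qed.

Lemma capelli_powers_neq0 (K : closedFieldType) n m : (m <= n)%N ->
  exists (x : nat -> 'M[K]_n.+1) (d : 'rV[K]_n.+1),
    capelli_powers m x (diag_mx d) != 0.
Proof.
move=> le_mn; have [r sz_r uniq_r] := closed_field_uniq K n.+1.
exists (fun j => delta_mx (inord j.-1) (inord j)), (\row_j r`_j).
set D := diag_mx _.
have DX k : D ^+ k = diag_mx (\row_j r`_j ^+ k).
  rewrite -[D]horner_mx_X -rmorphXn /= horner_mx_diag.
  by congr diag_mx; apply/rowP => j; rewrite !mxE hornerXn.
have deltaD (i j : 'I_n.+1) k :
    delta_mx i j * D ^+ k = r`_j ^+ k *: delta_mx i j.
  rewrite DX -[LHS]/(_ *m _) mul_mx_diag; apply/matrixP => a b.
  by rewrite !mxE; case: (b =P j) => [->|]; rewrite ?andbF ?mul0r ?mulr0 // mulrC.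
pose V := Vandermonde m.+1 (\row_(j < m.+1) r`_j).
suff -> : capelli_powers m (fun j => delta_mx (inord j.-1) (inord j)) D =
          \det V *: delta_mx (inord 0) (inord m).
  rewrite scaler_eq0 negb_or; apply/andP; split; last first.
    apply/eqP => /matrixP /(_ (inord 0) (inord m)).
    by rewrite !mxE !eqxx => /eqP; rewrite oner_eq0.
  rewrite det_Vandermonde; apply/prodf_neq0 => i _; apply/prodf_neq0 => j lt_ij.
  rewrite !mxE subr_eq0 nth_uniq ?sz_r ?(leq_trans (ltn_ord _)) //.
  by rewrite neq_ltn lt_ij orbT.
(* [Vandermonde] has the exponent as row index, whereas here s acts on exponents; hence the
   transpose. *)
rewrite -det_tr [\det _](eq_bigr (fun s : 'S_m.+1 =>
  (-1) ^+ s * \prod_(j < m.+1) r`_j ^+ s j)); last first.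
  by move=> s _; congr (_ * _); apply: eq_bigr => j _; rewrite !mxE.
rewrite scaler_suml; apply: eq_bigr => s _.
under eq_bigr => j _ do
  rewrite deltaD inordK ?(leq_trans (ltn_ord _)) //.
rewrite scaler_prod prod_delta_mx_path // -scalerA.
by case: (odd_perm s); rewrite ?mul1r ?scale1r // expr1 mulN1r scaleN1r.
Qed.

(** * Annihilators of half degree for symplectic-symmetric matrices *)

Lemma natr2_neq0 (K : fieldType) : 2%N \notin [pchar K] -> 2%:R != 0 :> K.
Proof. by rewrite inE /=. Qed.

(** A is congruent, through its row space, to an invertible skew S of size r = rank A; then det S =
    (-1)^r det S forces r even. *)
Lemma skew_mx_rank_even (K : fieldType) n (A : 'M[K]_n) :
  2%N \notin [pchar K] -> A^T = - A -> ~~ odd (\rank A).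
Proof.
move=> charK skA.
(* The rank becomes a variable [r] because it is a dimension in the types of the factors. *)
have [r [C [V [R [rA CV VR]]]]] :
    exists r (C : 'M_(n, r)) (V : 'M_(r, n)) (R : 'M_(n, r)),
      [/\ r = \rank A, C *m V = A & V *m R = 1%:M].
  have /row_freeP [R VR] := row_base_free A.
  by exists (\rank A), (col_base A), (row_base A), R; rewrite mulmx_base.
rewrite -rA; pose S := R^T *m A *m R.
have ARV : A *m R *m V = A by rewrite -CV -(mulmxA C) VR mulmx1.
have AE : A = V^T *m S *m V.
  rewrite /S !mulmxA -trmx_mul -[A in RHS]trmxK -trmx_mul skA mulNmx.
  by rewrite mulmxA ARV linearN /= skA opprK.
have skS : S^T = - S.
  by rewrite /S !trmx_mul trmxK skA mulNmx mulmxN mulmxA.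
have uS : S \in unitmx.
  rewrite -row_free_unit /row_free eqn_leq rank_leq_row /=.
  rewrite {1}rA {1}AE (leq_trans (mxrankM_maxl _ _)) //.
  exact: mxrankM_maxr.
apply/negP => odd_r; move: uS; rewrite unitmxE unitfE => /negP; apply.
have := congr1 determinant skS.
rewrite det_tr -scaleN1r detZ -signr_odd odd_r expr1 mulN1r => /eqP.
by rewrite -addr_eq0 -mulr2n -mulr_natl mulf_eq0 (negPf (natr2_neq0 charK)).
Qed.

(** The nonzero row space of Q is W-stable, so W has an eigenvector in it; that vector is killed by
    W - a. *)
Lemma rank_mul_eigen_lt (K : closedFieldType) n (Q W : 'M[K]_n.+1) :
  Q != 0 -> Q *m W = W *m Q ->
  exists a : K, (\rank (Q *m (W - a%:M)) < \rank Q)%N.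
Proof.
move=> Q0 cQW; pose V := row_base Q.
have /submxP [W' VW] : (V *m W <= V)%MS.
  by rewrite (eqmxMr _ (eq_row_base Q)) eq_row_base cQW submxMl.
have rQ : (0 < \rank Q)%N by rewrite lt0n mxrank_eq0.
have /closed_rootP [a] : size (char_poly W') != 1.
  by rewrite size_char_poly eqSS -lt0n.
rewrite -eigenvalue_root_char => /eigenvalueP [u uW u0].
exists a; rewrite -[X in (_ < X)%N](mxrank_mul_ker Q (W - a%:M)) -addn1 leq_add2l.
rewrite lt0n mxrank_eq0; apply/rowV0Pn; exists (u *m V).
  rewrite sub_capmx; apply/andP; split.
    by rewrite -(eq_row_base Q) submxMl.
  apply/sub_kermxP; rewrite mulmxBr -mulmxA VW mulmxA uW.
  by rewrite -scalemxAl mul_mx_scalar subrr.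
by rewrite -mxrank_eq0 mxrankMfree ?row_base_free // mxrank_eq0.
Qed.

(* Each linear factor kills an eigenvector of [W] in the image of [q(W)], and  *)
(* [q(W) T] is skew, hence of even rank: the rank drops by at least 2.         *)
Lemma symplectic_sym_annihilator (K : closedFieldType) n (T W : 'M[K]_n.+1) :
  2%N \notin [pchar K] -> T \in unitmx -> T^T = - T -> W *m T = T *m W^T ->
  forall j : nat, exists2 q : {poly K}, size q = j.+1 &
    (\rank (horner_mx W q) <= n.+1 - j.*2)%N.
Proof.
move=> charK uT skT WT.
(* The induction also carries the relation that makes q(W) T skew. *)
suff H j : exists q : {poly K}, [/\ size q = j.+1,
    (\rank (horner_mx W q) <= n.+1 - j.*2)%N &
    horner_mx W q *m T = T *m (horner_mx W q)^T].
  by move=> j; have [q [? ? _]] := H j; exists q.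
have evenQ Q : Q *m T = T *m Q^T -> ~~ odd (\rank Q).
  move=> QT; rewrite -(mxrankMfree Q (B := T)) ?row_free_unit //.
  by apply: skew_mx_rank_even => //; rewrite trmx_mul skT mulNmx -QT.
elim: j => [|j [q [sz_q rk_q qT]]].
  exists 1; rewrite size_poly1 rmorph1 subn0 rank_leq_row trmx1.
  by rewrite mul1mx mulmx1.
set Q := horner_mx W q in rk_q qT.
have cQW : Q *m W = W *m Q by apply: comm_horner_mx.
have q0 : q != 0 by rewrite -size_poly_eq0 sz_q.
have step a : let p := q * ('X - a%:P) in
  [/\ size p = j.+2, horner_mx W p = Q *m (W - a%:M)
    & horner_mx W p *m T = T *m (horner_mx W p)^T].
  have pW : horner_mx W (q * ('X - a%:P)) = Q *m (W - a%:M).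
    by rewrite rmorphM rmorphB /= horner_mx_X horner_mx_C.
  split=> //; first by rewrite size_Mmonic ?monicXsubC // sz_q size_XsubC addn2.
  rewrite pW -mulmxA mulmxBl WT -scalar_mxC -mulmxBr mulmxA qT -mulmxA.
  congr (_ *m _); rewrite -[a%:M]tr_scalar_mx -linearB -trmx_mul.
  by rewrite mulmxBl mulmxBr -cQW tr_scalar_mx scalar_mxC.
(* Once q(W) = 0, any linear factor serves to raise the degree. *)
have [Q0|Q0] := eqVneq Q 0.
  have [sz_p pW pT] := step 0; exists (q * ('X - 0%:P)); split=> //.
  by rewrite pW Q0 mul0mx mxrank0.
have [a lt_rk] := rank_mul_eigen_lt Q0 cQW.
have [sz_p pW pT] := step a; exists (q * ('X - a%:P)); split=> //.
have odd_p := evenQ _ pT; have odd_q := evenQ _ qT.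
rewrite pW in odd_p *.
have : (\rank (Q *m (W - a%:M)) + 2 <= \rank Q)%N.
  rewrite addn2 ltn_neqAle lt_rk andbT; apply/eqP => e.
  by move: odd_q; rewrite -e /= odd_p.
move=> /leq_trans /(_ rk_q) /(leq_sub2r 2).
by rewrite addnK doubleS -[_.+2 in X in _ -> X]addn2 subnDA.
Qed.

(** * Block embeddings *)

Lemma mul_rowsub1_tr (K : fieldType) n p q (f : 'I_p -> 'I_n) (g : 'I_q -> 'I_n) :
  rowsub f 1%:M *m (rowsub g 1%:M)^T = \matrix_(i, j) (f i == g j)%:R :> 'M[K]_(p, q).
Proof.
rewrite trmx_mxsub trmx1 mulmx_colsub mulmx1.
by apply/matrixP => i j; rewrite !mxE.
Qed.

Lemma rowsub1_tr_id (K : fieldType) n p (f : 'I_p -> 'I_n) :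
  injective f -> rowsub f 1%:M *m (rowsub f 1%:M)^T = 1%:M :> 'M[K]_p.
Proof.
move=> inj_f; rewrite mul_rowsub1_tr; apply/matrixP => i j.
by rewrite !mxE inj_eq.
Qed.

Lemma isometry_exists (K : fieldType) p n : (p <= n)%N ->
  exists P : 'M[K]_(p, n), P *m P^T = 1%:M.
Proof.
move=> le_pn; exists (rowsub (widen_ord le_pn) 1%:M); apply: rowsub1_tr_id.
by move=> i j /(congr1 val) /= /val_inj.
Qed.

(* The rows of [L] and [R] are the two halves of the canonical basis.          *)
Lemma symplectic_basis (K : fieldType) m : ~~ odd m.+1 ->
  let T := symplectic_mx K m in
  exists L R : 'M[K]_(m.+1./2, m.+1),
    [/\ L *m L^T = 1%:M, R *m R^T = 1%:M, L *m R^T = 0 &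
     [/\ L *m T = R, R *m T = - L & L^T *m L + R^T *m R = 1%:M]].
Proof.
move=> ev T; set k := m.+1./2.
have dm : (k + k)%N = m.+1 by rewrite addnn -[RHS]odd_double_half (negPf ev).
have lE (i : 'I_k) : (inord i : 'I_m.+1) = i :> nat.
  by rewrite inordK // -dm ltn_addr.
have rE (i : 'I_k) : (inord (i + k) : 'I_m.+1) = (i + k)%N :> nat.
  by rewrite inordK // -dm ltn_add2r.
pose L : 'M[K]_(k, m.+1) := rowsub (fun i : 'I_k => inord i) 1%:M.
pose R : 'M[K]_(k, m.+1) := rowsub (fun i : 'I_k => inord (i + k)) 1%:M.
have LL : L *m L^T = 1%:M.
  by apply: rowsub1_tr_id => i j /(congr1 val) /=; rewrite !lE => /val_inj.
have RR : R *m R^T = 1%:M.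
  apply: rowsub1_tr_id => i j /(congr1 val) /=; rewrite !rE => /addIn.
  exact: val_inj.
have LR : L *m R^T = 0.
  rewrite mul_rowsub1_tr; apply/matrixP => i j; rewrite !mxE -val_eqE /=.
  by rewrite lE rE ltn_eqF // (leq_trans (ltn_ord i)) ?leq_addl.
have RL : R *m L^T = 0 by rewrite -[LHS]trmxK trmx_mul trmxK LR trmx0.
have TE : T = L^T *m R - R^T *m L.
  apply/matrixP => a b; rewrite summxE !mxE -sumrB; apply: eq_bigr => i _.
  rewrite !mxE -!natrM !mulnb.
  by rewrite ![inord _ == _]eq_sym.
have LT : L *m T = R.
  by rewrite TE mulmxBr !mulmxA LL LR mul1mx mul0mx subr0.
have RT : R *m T = - L.
  by rewrite TE mulmxBr !mulmxA RR RL mul1mx mul0mx sub0r.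
exists L, R; split=> //; split=> //.
(* Expand one factor of T in T^2 = -1. *)
rewrite -[RHS]opprK -symplectic_mx_sqr // -/T {1}TE mulmxBl -!mulmxA LT RT.
by rewrite mulmxN opprB opprK addrC.
Qed.

Lemma symplectic_starE (K : fieldType) m (a : 'M[K]_m.+1) : ~~ odd m.+1 ->
  symplectic_star a = - (symplectic_mx K m *m a^T *m symplectic_mx K m).
Proof.
move=> ev; rewrite /symplectic_star.
have -> : invmx (symplectic_mx K m) = - symplectic_mx K m.
  rewrite -[RHS](mulKmx (symplectic_mx_unit K ev)) mulmxN symplectic_mx_sqr //.
  by rewrite opprK mulmx1.
by rewrite mulmxN.
Qed.

(** The unit goes to the idempotent E^T E, and b -> E b E^T is a left inverse. *)
Lemma corner_embedding (K : fieldType) n p (E : 'M[K]_(p.+1, n.+1)) :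
  E *m E^T = 1%:M -> alg_embedding (fun a : 'M[K]_p.+1 => E^T *m a *m E).
Proof.
move=> EE; split=> [|c a b|a b].
- apply: (can_inj (g := fun b => E *m b *m E^T)) => a.
  by rewrite !mulmxA EE mul1mx -mulmxA EE mulmx1.
- by rewrite mulmxDr mulmxDl -scalemxAr -scalemxAl.
- rewrite -[LHS]/(_ *m (_ *m _) *m _) -[RHS]/(_ *m _) !mulmxA.
  by rewrite -(mulmxA _ E) EE mulmx1.
Qed.

Lemma transpose_embedding (K : fieldType) m1 m2 : (m2 <= m1)%N ->
  exists phi : 'M[K]_m2.+1 -> 'M[K]_m1.+1,
    star_embedding (mx_star Transpose) (mx_star Transpose) phi.
Proof.
move=> le_m; have [E EE] := isometry_exists K (le_m : (m2.+1 <= m1.+1)%N).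
exists (fun a => E^T *m a *m E); split; first exact: corner_embedding.
by move=> a; rewrite /= !trmx_mul trmxK mulmxA.
Qed.

Lemma symplectic_embedding (K : fieldType) m1 m2 :
  ~~ odd m1.+1 -> ~~ odd m2.+1 -> (m2 <= m1)%N ->
  exists phi : 'M[K]_m2.+1 -> 'M[K]_m1.+1,
    star_embedding (mx_star Symplectic) (mx_star Symplectic) phi.
Proof.
move=> ev1 ev2 le_m.
have [P PP] := isometry_exists K (half_leq (le_m : (m2.+1 <= m1.+1)%N)).
have [L1 [R1 [LL1 RR1 LR1 [LT1 RT1 _]]]] := symplectic_basis K ev1.
have [L2 [R2 [_ _ _ [LT2 RT2 sum2]]]] := symplectic_basis K ev2.
have RL1 : R1 *m L1^T = 0 by rewrite -[LHS]trmxK trmx_mul trmxK LR1 trmx0.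
(* Each half of the small basis goes into the corresponding half of the large one, which keeps the
   pairing of i with i + k and gives E T1 = T2 E. *)
pose E := L2^T *m P *m L1 + R2^T *m P *m R1.
set T1 := symplectic_mx K m1 in LT1 RT1.
set T2 := symplectic_mx K m2 in LT2 RT2.
have EE : E *m E^T = 1%:M.
  rewrite -sum2 /E linearD /= !trmx_mul !trmxK mulmxDl !mulmxDr.
  rewrite !mulmxA -!(mulmxA _ L1) -!(mulmxA _ R1) LL1 RR1 LR1 RL1.
  by rewrite !mulmx0 !mul0mx !mulmx1 addr0 add0r -!(mulmxA _ P) PP !mulmx1.
have TL2 : T2 *m L2^T = - R2^T.
  by rewrite -LT2 trmx_mul tr_symplectic_mx mulNmx opprK.
have TR2 : T2 *m R2^T = L2^T.
  by apply: oppr_inj; rewrite -mulNmx -tr_symplectic_mx -trmx_mul RT2 linearN.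
have ET : E *m T1 = T2 *m E.
  rewrite /E mulmxDl mulmxDr -!mulmxA LT1 RT1 !mulmxA TL2 TR2.
  by rewrite mulmxN !mulNmx addrC.
have TE : T1 *m E^T = E^T *m T2.
  have := congr1 trmx ET; rewrite !trmx_mul !tr_symplectic_mx mulNmx mulmxN.
  exact: oppr_inj.
exists (fun a => E^T *m a *m E); split; first exact: corner_embedding.
move=> a; rewrite /= !symplectic_starE // -/T1 -/T2 !trmx_mul trmxK.
by rewrite mulmxN mulNmx !mulmxA TE -!mulmxA ET.
Qed.

(** Placing a once in each half gives diag(a, a), padded with zeros; T commutes with such matrices,
    so s acts on them as t. *)
Lemma transpose_symplectic_embedding (K : fieldType) m1 m2 :
  ~~ odd m1.+1 -> (m2.+1 <= m1.+1./2)%N ->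
  exists phi : 'M[K]_m2.+1 -> 'M[K]_m1.+1,
    star_embedding (mx_star Transpose) (mx_star Symplectic) phi.
Proof.
move=> ev le_m; have [P PP] := isometry_exists K le_m.
have [L [R [LL RR LR [LT RT _]]]] := symplectic_basis K ev.
set T := symplectic_mx K m1 in LT RT.
pose F := P *m L; pose G := P *m R.
have FF : F *m F^T = 1%:M.
  by rewrite trmx_mul mulmxA -(mulmxA P) LL mulmx1.
have GG : G *m G^T = 1%:M.
  by rewrite trmx_mul mulmxA -(mulmxA P) RR mulmx1.
have FG : F *m G^T = 0.
  by rewrite trmx_mul mulmxA -(mulmxA P) LR mulmx0 mul0mx.
have GF : G *m F^T = 0 by rewrite -[LHS]trmxK trmx_mul trmxK FG trmx0.
have FT : F *m T = G by rewrite -mulmxA LT.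
have GT : G *m T = - F by rewrite -mulmxA RT mulmxN.
clearbody F G.
have TF : T *m F^T = - G^T.
  by rewrite -FT trmx_mul tr_symplectic_mx mulNmx opprK.
have TG : T *m G^T = F^T.
  by apply: oppr_inj; rewrite -mulNmx -tr_symplectic_mx -trmx_mul GT linearN.
pose phi (a : 'M[K]_m2.+1) := F^T *m a *m F + G^T *m a *m G.
have [_ linF mulF] := corner_embedding FF.
have [_ linG mulG] := corner_embedding GG.
exists phi; split; first split=> [|c a b|a b].
- apply: (can_inj (g := fun b => F *m b *m F^T)) => a.
  rewrite /phi mulmxDr mulmxDl !mulmxA FF FG mul1mx !mul0mx addr0.
  by rewrite -mulmxA FF mulmx1.
- by rewrite /phi linF linG scalerDr addrACA.
- rewrite /phi mulF mulG mulrDl !mulrDr.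
  have -> : F^T *m a *m F * (G^T *m b *m G) = 0.
    by rewrite -[LHS]/(_ *m _) !mulmxA -(mulmxA _ F) FG mulmx0 !mul0mx.
  have -> : G^T *m a *m G * (F^T *m b *m F) = 0.
    by rewrite -[LHS]/(_ *m _) !mulmxA -(mulmxA _ G) GF mulmx0 !mul0mx.
  by rewrite addr0 add0r.
- move=> a; rewrite /= symplectic_starE // -/T /phi linearD /= !trmx_mul !trmxK.
  rewrite mulmxDr mulmxDl !mulmxA TF TG -!mulmxA FT GT.
  by rewrite !mulNmx !mulmxN opprD !opprK addrC.
Qed.

(** * Splitting into symmetric and skew parts *)

Section StarParts.

Variables (K : fieldType) (A : algType K) (star : A -> A).

Definition sym_part (a : A) : A := 2%:R^-1 *: (a + star a).
Definition skew_part (a : A) : A := 2%:R^-1 *: (a - star a).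

Hypotheses (charK : 2%N \notin [pchar K]) (invol : is_involution star).

Let half_double (a : A) : 2%:R^-1 *: (a + a) = a.
Proof.
have two0 := natr2_neq0 charK.
by rewrite -[a + a]/(a *+ 2) -scaler_nat scalerA mulVf // scale1r.
Qed.

Let starD a b : star (a + b) = star a + star b.
Proof. by case: invol => lin _ _; have := lin 1 a b; rewrite !scale1r. Qed.

Let star0 : star 0 = 0.
Proof. by apply: (addrI (star 0)); rewrite -starD !addr0. Qed.

Let starZ c a : star (c *: a) = c *: star a.
Proof.
by case: invol => lin _ _; have := lin c a 0; rewrite star0 !addr0.
Qed.

Let starN a : star (- a) = - star a.
Proof. by rewrite -scaleN1r starZ scaleN1r. Qed.

Lemma sym_partP a : symmetric_elt star (sym_part a).
Proof.
case: invol => _ _ starK.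
by rewrite /symmetric_elt /sym_part starZ starD starK addrC.
Qed.

Lemma skew_partP a : skew_elt star (skew_part a).
Proof.
case: invol => _ _ starK; rewrite /skew_elt /skew_part.
by rewrite starZ starD starN starK -scalerN opprB addrC.
Qed.

Lemma sym_skew_part a : sym_part a + skew_part a = a.
Proof. by rewrite -scalerDr addrACA subrr addr0 half_double. Qed.

Lemma sym_part_id a : symmetric_elt star a -> sym_part a = a.
Proof. by rewrite /sym_part => ->; rewrite half_double. Qed.

End StarParts.

(** * Size bounds from inclusion of identities *)

Section CapelliIdentity.

Variable K : closedFieldType.

Definition sym_var i : free_star_alg K := << fmu (inl i) >>.
(** With 2 invertible, y_i + z_i takes every value of the algebra. *)
Definition gen_var i : free_star_alg K := << fmu (inl i) >> + << fmu (inr i) >>.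

(** The shift [j.+1] reserves index 0 for the variables of w. *)
Lemma eval_capelli (A : algType K) (u v : nat -> A) m w :
  free_eval u v (capelli_powers m (fun j => gen_var j.+1) w) =
  capelli_powers m (fun j => u j.+1 + v j.+1) (free_eval u v w).
Proof.
rewrite rmorph_capelli_powers; apply: eq_bigr => s _; congr (_ * _).
by apply: eq_bigr => j _; rewrite /= rmorphD /= !free_evalU.
Qed.

Lemma star_identity_capelli (A : algType K) (star : A -> A) m w
    (x : nat -> A) :
  2%N \notin [pchar K] -> is_involution star ->
  star_identity star (capelli_powers m (fun j => gen_var j.+1) w) ->
  capelli_powers m (fun j => x j.+1)
    (free_eval (sym_part star \o x) (skew_part star \o x) w) = 0.
Proof.
move=> charK invol idA; rewrite -[RHS](idA (sym_part star \o x) (skew_part star \o x)).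
- rewrite eval_capelli; apply: eq_bigr => s _; congr (_ * _).
  by apply: eq_bigr => j _; rewrite /= sym_skew_part.
- by move=> i; apply: sym_partP.
- by move=> i; apply: skew_partP.
Qed.

Lemma star_identities_sub_leq (charK : 2%N \notin [pchar K]) m1 m2
    (star1 : 'M[K]_m1.+1 -> 'M[K]_m1.+1) (star2 : 'M[K]_m2.+1 -> 'M[K]_m2.+1) :
  is_involution star2 -> star_identities_sub star1 star2 -> (m2 <= m1)%N.
Proof.
move=> invol2 sub; rewrite leqNgt; apply/negP => lt_m.
have [x [d /eqP]] := capelli_powers_neq0 K lt_m; apply.
pose X := fun i : nat => if i is j.+1 then x j else diag_mx d.
have /sub id2 : star_identity star1
    (capelli_powers m1.+1 (fun j => gen_var j.+1) (gen_var 0)).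
  move=> u v _ _; rewrite eval_capelli.
  apply: (@capelli_powers_annihilated _ _ _ _ _ (char_poly _)).
    by rewrite size_char_poly.
  exact: Cayley_Hamilton.
have := star_identity_capelli X charK invol2 id2.
by rewrite rmorphD /= !free_evalU /= sym_skew_part.
Qed.

(** Taking w = y, without z, restricts w to symmetric values: these have degree at most n_1/2 under
    s, yet include all diagonal matrices under t. *)
Lemma symplectic_transpose_leq (charK : 2%N \notin [pchar K]) m1 m2 :
  ~~ odd m1.+1 ->
  star_identities_sub (mx_star Symplectic : 'M[K]_m1.+1 -> 'M[K]_m1.+1)
                      (mx_star Transpose : 'M[K]_m2.+1 -> 'M[K]_m2.+1) ->
  (m2.+1 <= m1.+1./2)%N.
Proof.
move=> ev sub; rewrite leqNgt; apply/negP => lt_m.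
have [x [d /eqP]] := capelli_powers_neq0 K (lt_m : (m1.+1./2 <= m2)%N); apply.
pose X := fun i : nat => if i is j.+1 then x j else diag_mx d.
have inv2 : is_involution (mx_star Transpose : 'M[K]_m2.+1 -> 'M[K]_m2.+1).
  exact: mx_star_involution.
have /sub id2 : star_identity
    (mx_star Symplectic : 'M[K]_m1.+1 -> 'M[K]_m1.+1)
    (capelli_powers m1.+1./2 (fun j => gen_var j.+1) (sym_var 0)).
  move=> u v symu _; rewrite eval_capelli free_evalU.
  set W := u 0; set T := symplectic_mx K m1.
  have uT : T \in unitmx by exact: symplectic_mx_unit.
  have WT : W *m T = T *m W^T.
    by rewrite -{1}[W]symu /= /symplectic_star mulmxKV.
  (* At j = n_1/2 the rank bound n_1 - 2j is 0, so q(W) = 0. *)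
  have [q sz_q] :=
    symplectic_sym_annihilator charK uT (tr_symplectic_mx _ _) WT m1.+1./2.
  rewrite even_halfK // subnn leqn0 mxrank_eq0 => /eqP qW.
  exact: (capelli_powers_annihilated _ sz_q qW).
have := star_identity_capelli X charK inv2 id2.
rewrite free_evalU /= sym_part_id //.
by rewrite /symmetric_elt /= tr_diag_mx.
Qed.

End CapelliIdentity.

(* n_1 = m1.+1 and n_2 = m2.+1. *)
Theorem proposition3 (K : closedFieldType) (charK : 2%N \notin [pchar K])
    (m1 m2 : nat) (s1 s2 : star_kind)
    (even1 : s1 = Symplectic -> ~~ odd m1.+1)
    (even2 : s2 = Symplectic -> ~~ odd m2.+1) :
  [/\ (* (a) *)
      star_identities_sub (mx_star s1 : 'M[K]_m1.+1 -> 'M[K]_m1.+1)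
                          (mx_star s2 : 'M[K]_m2.+1 -> 'M[K]_m2.+1) ->
      exists phi : 'M[K]_m2.+1 -> 'M[K]_m1.+1, alg_embedding phi,
      (* (b) *)
      s1 = s2 ->
      star_identities_sub (mx_star s1 : 'M[K]_m1.+1 -> 'M[K]_m1.+1)
                          (mx_star s2 : 'M[K]_m2.+1 -> 'M[K]_m2.+1) ->
      exists phi : 'M[K]_m2.+1 -> 'M[K]_m1.+1,
        star_embedding (mx_star s2) (mx_star s1) phi
    & (* (c) *)
      s1 = Symplectic ->
      star_identities_sub (mx_star s1 : 'M[K]_m1.+1 -> 'M[K]_m1.+1)
                          (mx_star s2 : 'M[K]_m2.+1 -> 'M[K]_m2.+1) ->
      exists phi : 'M[K]_m2.+1 -> 'M[K]_m1.+1,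
        star_embedding (mx_star s2) (mx_star s1) phi].
Proof.
have leq_m := star_identities_sub_leq charK (mx_star_involution K even2).
have same_kind s : s1 = s -> s2 = s -> (m2 <= m1)%N ->
    exists phi : 'M[K]_m2.+1 -> 'M[K]_m1.+1,
      star_embedding (mx_star s2) (mx_star s1) phi.
  case: s => e1 e2 le_m; rewrite e1 e2; first exact: transpose_embedding.
  exact: symplectic_embedding (even1 e1) (even2 e2) le_m.
split.
(* Part (a) ignores involutions, so the corner embedding for t serves for all kinds. *)
- by move=> /leq_m /(@transpose_embedding K) [phi [emb _]]; exists phi.
- by move=> e12 /leq_m; apply: same_kind e12 _.
- case: s2 even2 leq_m same_kind => _ leq_m same_kind e1 sub.
    rewrite e1 in sub *.
    apply: transpose_symplectic_embedding; first exact: even1.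
    exact: symplectic_transpose_leq (even1 e1) sub.
  exact: same_kind e1 _ (leq_m _ _ sub).
Qed.
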